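(* Let $1\le r\le n$ and let $\mathcal{C}=\{X\in\mathbb{R}^{n\times r}:X^\top X=\mathbf{I}_r\}$. Then, with respect to the nuclear norm $\|\cdot\|=\|\cdot\|_{\mathrm{nuc}}$ and its dual, the spectral norm $\|\cdot\|^*=\|\cdot\|_{\mathrm{sp}}$, $\mathcal{C}$ has local concavity coefficients $\gamma_X(\mathcal{C})=\frac12$ for all $X\in\mathcal{C}$. Moreover the norm compatibility condition holds with $\phi=1$, i.e. $\|Z-P_{\mathcal{C}}(Z)\|_{\mathrm{sp}}\le\min_{X\in\mathcal{C}}\|Z-X\|_{\mathrm{sp}}$ for all $Z\in\mathbb{R}^{n\times r}$.
   Context: $\|X\|_{\mathrm{nuc}}$ is the sum of the singular values of $X$, $\|X\|_{\mathrm{sp}}$ the largest singular value, $\|X\|_F$ the Frobenius norm and $\langle\cdot,\cdot\rangle$ the trace inner product. $P_{\mathcal{C}}(Z)\in\arg\min_{X\in\mathcal{C}}\|X-Z\|_F$; if the minimizer is non-unique, $P_{\mathcal{C}}(Z)$ denotes any minimizer, claims involving it are to hold for every choice, and ''$P_{\mathcal{C}}(Z)=X$'' means that $X$ is a minimizer. Degenerate points: $\mathcal{C}_{\mathrm{dgn}}=\{X\in\mathcal{C}:P_{\mathcal{C}}\text{ is not continuous over any neighborhood of }X\}$. Local concavity coefficients: $\gamma_X(\mathcal{C})=\infty$ if $X\in\mathcal{C}_{\mathrm{dgn}}$, and for $X\in\mathcal{C}\setminus\mathcal{C}_{\mathrm{dgn}}$, $\gamma_X(\mathcal{C})$ is the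 smallest $\gamma\in[0,\infty]$ such that $\langle Y-X,Z-X\rangle\le\gamma\|Z-X\|^*\|Y-X\|_F^2$ for all $Y\in\mathcal{C}$ and all $Z\in\mathbb{R}^{n\times r}$ with $P_{\mathcal{C}}(Z)=X$. *)

(* Defs.v *)
From HB Require Import structures.
From mathcomp Require Import all_boot all_order all_algebra.
From mathcomp Require Import polyrcf.
From mathcomp Require Import all_classical all_reals all_analysis.
Set Implicit Arguments.
Unset Strict Implicit.
Unset Printing Implicit Defensive.
Import Order.TTheory GRing.Theory Num.Theory.
Import numFieldNormedType.Exports.
Local Open Scope classical_set_scope.
Local Open Scope ring_scope.

Section Norms.
Variables (R : realType) (n r : nat).
Implicit Types X Y Z : 'M[R]_(n, r).

Definition mxdot X Y : R := \tr (X^T *m Y).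

Definition frob_norm X : R := Num.sqrt (mxdot X X).

(* Square roots of the eigenvalues of X^T X, repeated according to algebraic
   multiplicity (there are r of them, all real and nonnegative, since X^T X is
   positive semidefinite).  [rootsR p] lists the distinct roots of p in R. *)
Definition singular_values X : seq R :=
  let p := char_poly (X^T *m X) in
  flatten [seq nseq (mup x p) (Num.sqrt x) | x <- rootsR p].

Definition nuc_norm X : R := \sum_(s <- singular_values X) s.

Definition sp_norm X : R := \big[Num.max/0]_(s <- singular_values X) s.

Definition dual_norm (N : 'M[R]_(n, r) -> R) Z : R :=
  sup [set mxdot X Z | X in [set X | N X <= 1]].

Definition orthonormal_mx : set 'M[R]_(n, r) := [set X | X^T *m X = 1%:M].

End Norms.

Definition is_least d (T : porderType d) (A : set T) (m : T) : Prop :=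
  A m /\ (forall x, A x -> (m <= x)%O).

Section LocalConcavity.
Variables (R : realType) (n r : nat).
Variable C : set 'M[R]_(n, r).
Implicit Types X Y Z : 'M[R]_(n, r).

(* X is one of the possibly many values of the projection of Z onto C. *)
Definition is_proj Z X : Prop :=
  C X /\ (forall Y, C Y -> frob_norm (X - Z) <= frob_norm (Y - Z)).

Definition projection (P : 'M[R]_(n, r) -> 'M[R]_(n, r)) : Prop :=
  forall Z, is_proj Z (P Z).

Definition degenerate (P : 'M[R]_(n, r) -> 'M[R]_(n, r)) : set 'M[R]_(n, r) :=
  [set X | C X /\
    ~ exists2 U : set 'M[R]_(n, r), nbhs X U & {within U, continuous P}].

(* When N is a norm, g = +oo always qualifies: the factor multiplying g vanishes
   only if Z = X or Y = X, where both sides are 0 since +oo * 0 = 0 in \bar R. *)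
Definition concavity_bound (N : 'M[R]_(n, r) -> R) X (g : \bar R) : Prop :=
  (0 <= g)%E /\
  forall Y Z, C Y -> is_proj Z X ->
    ((mxdot (Y - X) (Z - X))%:E
       <= g * (dual_norm N (Z - X) * frob_norm (Y - X) ^+ 2)%:E)%E.

(* [local_concavity_coeff N P X g] says that g is the local concavity
   coefficient of C at X with respect to the norm N; the projection P matters
   only for deciding whether X is degenerate. *)
Definition local_concavity_coeff (N : 'M[R]_(n, r) -> R)
    (P : 'M[R]_(n, r) -> 'M[R]_(n, r)) X (g : \bar R) : Prop :=
  (degenerate P X -> g = +oo%E) /\
  (~ degenerate P X -> is_least [set h | concavity_bound N X h] g).

(* The condition is on the dual norm: D is to be instantiated by the dual of the
   norm used for the concavity coefficients. *)
Definition norm_compatible (D : 'M[R]_(n, r) -> R)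
    (P : 'M[R]_(n, r) -> 'M[R]_(n, r)) (phi : R) : Prop :=
  forall Z, exists2 m : R,
    is_least [set D (Z - X) | X in C] m & D (Z - P Z) <= phi * m.

End LocalConcavity.

(* Main.v *)
(* Testing the optimality of a projection X of Z against Q X, for Q a product of
   at most two Householder reflections, shows that Z X^T is symmetric positive
   semidefinite, whence Z = X S with S symmetric positive semidefinite.  For H
   symmetric and Y orthonormal, <X H, X - Y> = 1/2 tr ((X - Y) H (X - Y)^T) holds
   exactly.  With H = S - 1 this is the upper bound 1/2 on the concavity
   coefficient, attained at Z = 0, Y = -X; with H = S it makes the projection
   Lipschitz near the manifold.  For norm compatibility, S has a unit eigenvector
   u with |S u - u| = |Z - X|_sp, and then |(Z - Y) u| >= | |S u| - 1 | for every
   orthonormal Y. *)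
Require Import Defs.
From HB Require Import structures.
From mathcomp Require Import all_boot all_order all_algebra.
From mathcomp Require Import polyrcf complex ring lra.
From mathcomp Require Import all_classical all_reals all_analysis.
Set Implicit Arguments.
Unset Strict Implicit.
Unset Printing Implicit Defensive.
Import Order.TTheory GRing.Theory Num.Theory.
Import numFieldNormedType.Exports.
Local Open Scope classical_set_scope.
Local Open Scope ring_scope.

(** * Trace inner product and Frobenius norm *)

Section InnerProduct.
Context {R : realType}.

Lemma mxdotE m n (X Y : 'M[R]_(m, n)) : mxdot X Y = \sum_j \sum_i X i j * Y i j.
Proof.
rewrite /mxdot /mxtrace; apply: eq_bigr => j _; rewrite mxE.
by apply: eq_bigr => i _; rewrite mxE.
Qed.

Lemma mxdotC m n (X Y : 'M[R]_(m, n)) : mxdot X Y = mxdot Y X.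
Proof. by rewrite /mxdot -mxtrace_tr trmx_mul trmxK. Qed.

Lemma mxdotDl m n (X Y Z : 'M[R]_(m, n)) :
  mxdot (X + Y) Z = mxdot X Z + mxdot Y Z.
Proof. by rewrite /mxdot linearD mulmxDl linearD. Qed.

Lemma mxdotNl m n (X Z : 'M[R]_(m, n)) : mxdot (- X) Z = - mxdot X Z.
Proof. by rewrite /mxdot linearN mulNmx linearN. Qed.

Lemma mxdotZl m n a (X Z : 'M[R]_(m, n)) : mxdot (a *: X) Z = a * mxdot X Z.
Proof. by rewrite /mxdot linearZ -scalemxAl linearZ. Qed.

Lemma mxdotDr m n (X Y Z : 'M[R]_(m, n)) :
  mxdot Z (X + Y) = mxdot Z X + mxdot Z Y.
Proof. by rewrite !(mxdotC Z) mxdotDl. Qed.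

Lemma mxdotNr m n (X Z : 'M[R]_(m, n)) : mxdot Z (- X) = - mxdot Z X.
Proof. by rewrite !(mxdotC Z) mxdotNl. Qed.

Lemma mxdotZr m n a (X Z : 'M[R]_(m, n)) : mxdot Z (a *: X) = a * mxdot Z X.
Proof. by rewrite !(mxdotC Z) mxdotZl. Qed.

Definition mxdot_simp :=
  (mxdotDl, mxdotNl, mxdotZl, mxdotDr, mxdotNr, mxdotZr).

Lemma mxdot_mull m n p (A : 'M[R]_(m, n)) (X : 'M[R]_(n, p)) Y :
  mxdot (A *m X) Y = mxdot X (A^T *m Y).
Proof. by rewrite /mxdot trmx_mul mulmxA. Qed.

Lemma mxdot_mulr m n p (X : 'M[R]_(m, n)) (B : 'M[R]_(n, p)) Y :
  mxdot (X *m B) Y = mxdot X (Y *m B^T).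
Proof. by rewrite /mxdot trmx_mul -mulmxA mxtrace_mulC mulmxA. Qed.

Lemma mxdot_mulr_tr m n p (X : 'M[R]_(m, n)) (B : 'M[R]_(p, n)) Y :
  mxdot (X *m B^T) Y = mxdot X (Y *m B).
Proof. by rewrite mxdot_mulr trmxK. Qed.

Lemma mxdot_tr m n (X Y : 'M[R]_(m, n)) : mxdot X^T Y^T = mxdot X Y.
Proof. by rewrite /mxdot trmxK mxtrace_mulC -mxtrace_tr trmx_mul trmxK. Qed.

Lemma mxdot_isometry m n p (U : 'M[R]_(m, n)) (X Y : 'M[R]_(n, p)) :
  U^T *m U = 1%:M -> mxdot (U *m X) (U *m Y) = mxdot X Y.
Proof. by move=> U1; rewrite mxdot_mull mulmxA U1 mul1mx. Qed.

Lemma mxdot_col m n p (X Y : 'M[R]_(m, n)) (V : 'M[R]_(n, p)) :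
  mxdot (X *m V) (Y *m V) = \sum_i mxdot (X *m col i V) (Y *m col i V).
Proof.
rewrite mxdotE; apply: eq_bigr => i _; rewrite mxdotE big_ord1.
by apply: eq_bigr => j _; rewrite !mxE; congr (_ * _);
  apply: eq_bigr => k _; rewrite !mxE.
Qed.

Lemma mxdot_parseval m n (X Y : 'M[R]_(m, n)) (V : 'M[R]_n) :
  V^T *m V = 1%:M ->
  mxdot X Y = \sum_i mxdot (X *m col i V) (Y *m col i V).
Proof. by move=> V1; rewrite -mxdot_col mxdot_mulr -mulmxA mulmx1C ?mulmx1. Qed.

Lemma mxdot_ge0 m n (X : 'M[R]_(m, n)) : 0 <= mxdot X X.
Proof.
by rewrite mxdotE; apply: sumr_ge0 => j _; apply: sumr_ge0 => i _; rewrite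
  -expr2 sqr_ge0.
Qed.

Lemma mxdot_eq0 m n (X : 'M[R]_(m, n)) : (mxdot X X == 0) = (X == 0).
Proof.
apply/eqP/eqP => [|->]; last by rewrite /mxdot mulmx0 linear0.
have sq_ge0 j i : 0 <= X i j * X i j by rewrite -expr2 sqr_ge0.
rewrite mxdotE => /eqP; rewrite psumr_eq0; last by move=> j _; apply: sumr_ge0.
move=> /allP X0; apply/matrixP => i j; rewrite mxE.
have := X0 j (mem_index_enum _); rewrite /= psumr_eq0 // => /allP /(_ i
  (mem_index_enum _)).
by rewrite /= mulf_eq0 orbb => /eqP.
Qed.

Lemma mxdot_gt0 m n (X : 'M[R]_(m, n)) : (0 < mxdot X X) = (X != 0).
Proof. by rewrite lt_def mxdot_ge0 mxdot_eq0 andbT. Qed.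

Lemma frob_norm_ge0 m n (X : 'M[R]_(m, n)) : 0 <= frob_norm X.
Proof. exact: sqrtr_ge0. Qed.

Lemma sqr_frob_norm m n (X : 'M[R]_(m, n)) : frob_norm X ^+ 2 = mxdot X X.
Proof. by rewrite sqr_sqrtr // mxdot_ge0. Qed.

Lemma frob_normN m n (X : 'M[R]_(m, n)) : frob_norm (- X) = frob_norm X.
Proof. by rewrite /frob_norm !mxdot_simp opprK. Qed.

Lemma frob_norm_tr m n (X : 'M[R]_(m, n)) : frob_norm X^T = frob_norm X.
Proof. by rewrite /frob_norm mxdot_tr. Qed.

Lemma frob_norm_isometry m n p (U : 'M[R]_(m, n)) (X : 'M[R]_(n, p)) :
  U^T *m U = 1%:M -> frob_norm (U *m X) = frob_norm X.
Proof. by move=> U1; rewrite /frob_norm mxdot_isometry. Qed.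

Lemma frob_norm_eq0 m n (X : 'M[R]_(m, n)) : (frob_norm X == 0) = (X == 0).
Proof. by rewrite -mxdot_eq0 -sqr_frob_norm sqrf_eq0. Qed.

(** Cauchy-Schwarz: with [a] and [b] the two norms, the squared norm of [b *: X - a *: Y] is
    [2 * (a * b) * (a * b - mxdot X Y)]. *)
Lemma mxdot_le m n (X Y : 'M[R]_(m, n)) : mxdot X Y <= frob_norm X * frob_norm
  Y.
Proof.
set a := frob_norm X; set b := frob_norm Y.
have [/eqP|b0] := eqVneq b 0.
  by rewrite frob_norm_eq0 => /eqP ->; rewrite /mxdot mulmx0 linear0 mulr_ge0
    ?frob_norm_ge0.
have [/eqP|a0] := eqVneq a 0.
  by rewrite frob_norm_eq0 => /eqP ->; rewrite /mxdot trmx0 mul0mx linear0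
    mulr_ge0 ?frob_norm_ge0.
have ab : 0 < 2 * (a * b) by rewrite !mulr_gt0 // lt_def frob_norm_ge0 ?a0 ?b0.
have := mxdot_ge0 (b *: X - a *: Y); rewrite !mxdot_simp -!sqr_frob_norm (mxdotC
  Y X) -/a -/b => H.
rewrite -subr_ge0 -(pmulr_rge0 _ ab).
by apply: le_trans H _; rewrite le_eqVlt; apply/orP; left; apply/eqP; ring.
Qed.

Lemma frob_normD m n (X Y : 'M[R]_(m, n)) :
  frob_norm (X + Y) <= frob_norm X + frob_norm Y.
Proof.
rewrite -ler_sqr ?nnegrE ?addr_ge0 ?frob_norm_ge0 // sqr_frob_norm !mxdot_simp.
rewrite sqrrD !sqr_frob_norm (mxdotC Y X); have := mxdot_le X Y; lra.
Qed.

Lemma frob_normB_ge m n (X Y : 'M[R]_(m, n)) :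
  `|frob_norm X - frob_norm Y| <= frob_norm (X - Y).
Proof.
have := frob_normD (X - Y) Y; have := frob_normD (Y - X) X; rewrite !subrK.
by rewrite -(opprB X Y) frob_normN ler_norml; lra.
Qed.

Lemma frob_normZ m n (a : R) (X : 'M[R]_(m, n)) :
  frob_norm (a *: X) = `|a| * frob_norm X.
Proof. by rewrite /frob_norm !mxdot_simp mulrA -expr2 sqrtrM ?sqr_ge0 //
  sqrtr_sqr. Qed.

(** Each entry of the product pairs a row of [X] with a column of [Y]; Cauchy-Schwarz bounds its
    square, and the bounds are summed. *)
Lemma frob_norm_mul m n p (X : 'M[R]_(m, n)) (Y : 'M[R]_(n, p)) :
  frob_norm (X *m Y) <= frob_norm X * frob_norm Y.
Proof.
rewrite -ler_sqr ?nnegrE ?mulr_ge0 ?frob_norm_ge0 // exprMn !sqr_frob_norm.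
rewrite -(mxdot_tr X) 3!mxdotE mulr_sumr; apply: ler_sum => j _.
rewrite mulr_suml; apply: ler_sum => i _.
have E : (X *m Y) i j = mxdot (row i X)^T (col j Y).
  by rewrite mxdotE big_ord1 mxE; apply: eq_bigr => k _; rewrite !mxE.
have -> : \sum_k X^T k i * X^T k i = mxdot (row i X)^T (row i X)^T.
  by rewrite mxdotE big_ord1; apply: eq_bigr => k _; rewrite !mxE.
have -> : \sum_k Y k j * Y k j = mxdot (col j Y) (col j Y).
  by rewrite mxdotE big_ord1; apply: eq_bigr => k _; rewrite !mxE.
rewrite -expr2 E -!sqr_frob_norm -exprMn -[leLHS](real_normK (num_real _))
  ler_sqr ?nnegrE ?mulr_ge0 ?frob_norm_ge0 //.
rewrite ler_norml mxdot_le andbT lerNl -mxdotNl.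
by rewrite (le_trans (mxdot_le _ _)) // frob_normN.
Qed.
End InnerProduct.

(** * Householder reflections and matrices of maximal trace *)

Lemma quadratic_le0 (R : realFieldType) (b c : R) :
  (forall t, b * t <= c * t ^+ 2) -> b = 0.
Proof.
move=> H; apply/eqP; rewrite -sqrf_eq0 eq_le sqr_ge0 andbT.
have d0 : 0 < 1 + `|c| by rewrite ltr_pwDl.
(* Times the squared denominator, the hypothesis at this [t] reads
   [b ^+ 2 * (1 + |c|) <= b ^+ 2 * c], which forces [b = 0]. *)
have := H (b / (1 + `|c|)); rewrite -(ler_pM2r (exprn_gt0 2 d0)).
have -> : b * (b / (1 + `|c|)) * (1 + `|c|) ^+ 2 = b ^+ 2 * (1 + `|c|).
  by field; rewrite gt_eqF.
rewrite exprMn exprVn -!mulrA mulVf ?mulr1 ?expf_neq0 ?gt_eqF //.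
have := ler_norm c; have := sqr_ge0 b; nra.
Qed.

Section Reflections.
Context {R : realType} {n : nat}.
Implicit Types (u w : 'cV[R]_n) (M : 'M[R]_n).

(** The vector [u] is not normalized; [u = 0] gives the identity, so every [reflection u] is
    orthogonal. *)
Definition reflection u : 'M[R]_n := 1%:M - (2 / mxdot u u) *: (u *m u^T).

Lemma tr_reflection u : (reflection u)^T = reflection u.
Proof. by rewrite /reflection linearB /= linearZ /= trmx_mul trmxK trmx1. Qed.

Lemma mul_cV_dot u w : u^T *m w = (mxdot u w)%:M.
Proof. by rewrite /mxdot [LHS]mx11_scalar; congr (_%:M); rewrite /mxtrace
  big_ord1. Qed.

Lemma reflection_orthogonal u : (reflection u)^T *m reflection u = 1%:M.
Proof.
have [->|u0] := eqVneq u 0.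
  by rewrite /reflection mul0mx scaler0 subr0 trmx1 mulmx1.
rewrite -mxdot_gt0 in u0; rewrite tr_reflection /reflection; set a := 2 / _.
have aa : a * a * mxdot u u = a + a by rewrite /a; field; rewrite gt_eqF.
rewrite mulmxBl mul1mx mulmxBr mulmx1 -scalemxAl -scalemxAr scalerA.
rewrite mulmxA -(mulmxA u) mul_cV_dot mul_mx_scalar -scalemxAl scalerA aa.
by rewrite scalerDl opprB addrK subrK.
Qed.

Section MaximalTrace.
Variable M : 'M[R]_n.
Hypothesis maxM : forall Q : 'M[R]_n, Q^T *m Q = 1%:M -> mxdot Q M <= mxdot 1%:M
  M.

(** Replacing the identity by [reflection u] lowers the inner product with [M] by
    [2 / mxdot u u * mxdot u (M *m u)]. *)
Lemma maximal_trace_psd u : 0 <= mxdot u (M *m u).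
Proof.
have [->|u0] := eqVneq u 0; first by rewrite mulmx0 /mxdot mulmx0 linear0.
have := maxM (reflection_orthogonal u); rewrite -mxdot_gt0 in u0.
rewrite /reflection !mxdot_simp mxdot_mulr_tr gerDl oppr_le0 pmulr_rge0 //.
by rewrite divr_gt0.
Qed.

(** The reflections along [e i] and [e i + t *: e j] compose to a rotation of the plane of these two
    axes, equal to the identity at [t = 0]. The first-order term in [t] of the trace inequality is
    [M i j - M j i], so it must vanish. *)
Lemma maximal_trace_sym : M^T = M.
Proof.
apply/matrixP => i j; rewrite mxE; have [->//|ij] := eqVneq i j.
have ji : (j == i) = false by rewrite eq_sym (negPf ij).
pose e k : 'cV[R]_n := delta_mx k 0.
have Me k l : mxdot (e k) (M *m e l) = M k l.
  rewrite /e -colE mxdotE big_ord1 (bigD1 k) //= !mxE !eqxx mul1r big1 ?addr0 //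
    => l' /negPf nl.
  by rewrite !mxE nl mul0r.
have ee k l : mxdot (e k) (e l) = (k == l)%:R.
  rewrite mxdotE big_ord1 (bigD1 k) //= !mxE !eqxx mul1r andbT big1 ?addr0 // =>
    l' /negPf nl.
  by rewrite !mxE nl mul0r.
suff H : M i j - M j i = 0 by apply/eqP; rewrite eq_sym -subr_eq0 H.
apply: (@quadratic_le0 _ _ (M i i + M j j)) => t.
have [u uE] : exists u, u = e i by exists (e i).
have [w wE] : exists w, w = e i + t *: e j by exists (e i + t *: e j).
have ww : mxdot w w = 1 + t ^+ 2.
  by rewrite wE !mxdot_simp !ee !eqxx (negPf ij) ji /=; ring.
have uw : mxdot u w = 1 by rewrite uE wE !mxdot_simp !ee !eqxx (negPf ij) /=;
  ring.
have uu : mxdot u u = 1 by rewrite uE ee eqxx.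
have t0 : 0 < 1 + t ^+ 2 by rewrite ltr_pwDl ?sqr_ge0.
have : (reflection u *m reflection w)^T *m (reflection u *m reflection w) =
  1%:M.
  by rewrite trmx_mul mulmxA -(mulmxA _ (reflection u)^T) !reflection_orthogonal
    // mulmx1 reflection_orthogonal.
move/maxM; rewrite {1 2}/reflection mulmxBl mul1mx mulmxBr mulmx1.
rewrite -scalemxAl -scalemxAr mulmxA -(mulmxA u) mul_cV_dot mul_mx_scalar
  -scalemxAl.
rewrite !mxdot_simp !mxdot_mulr_tr uw uu ww uE wE !mulmxDr -!scalemxAr
  !mxdot_simp !Me.
rewrite -subr_ge0 => H; rewrite -subr_ge0.
(* Multiplying by half of [mxdot w w] clears the denominator of the second reflection and leaves
   exactly the quadratic inequality in [t]. *)
have c0 : 0 <= (1 + t ^+ 2) / 2 by rewrite divr_ge0 // ltW.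
apply: (le_trans (mulr_ge0 c0 H)); rewrite le_eqVlt; apply/orP; left; apply/eqP.
by field; rewrite gt_eqF.
Qed.

End MaximalTrace.
End Reflections.

(** * Projections onto the orthonormal matrices and the polar form *)

Section Stiefel.
Context {R : realType} {n r : nat}.
Implicit Types X Y Z W : 'M[R]_(n, r).
Local Notation C := (@orthonormal_mx R n r).

Lemma mxdot_orthonormal X : C X -> mxdot X X = \tr (1%:M : 'M[R]_r).
Proof. by rewrite /mxdot => ->. Qed.

(** The Frobenius norm is constant on [C], so the nearest points are those of largest inner product
    with [Z]. *)
Lemma is_proj_max Z X :
  is_proj C Z X -> C X /\ forall Y, C Y -> mxdot Y Z <= mxdot X Z.
Proof.
move=> [CX minX]; split=> // Y CY; have := minX Y CY.
rewrite -ler_sqr ?nnegrE ?frob_norm_ge0 // !sqr_frob_norm !mxdot_simp !(mxdotC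
  Z).
by rewrite (mxdot_orthonormal CX) (mxdot_orthonormal CY); lra.
Qed.

Lemma is_proj0 X : C X -> is_proj C 0 X.
Proof.
by move=> CX; split=> // Y CY; rewrite !subr0 /frob_norm !mxdot_orthonormal.
Qed.

(** The factor is [S = X^T *m Z]. Symmetry of [Z *m X^T] passes to [S] on compressing by [X], and
    gives [X *m S = X *m Z^T *m X = Z *m X^T *m X = Z]. *)
Lemma is_proj_polar Z X : is_proj C Z X ->
  exists S : 'M[R]_r,
    [/\ Z = X *m S, S^T = S & forall v : 'cV_r, 0 <= mxdot v (S *m v)].
Proof.
move=> /is_proj_max[CX maxX]; have X1 : X^T *m X = 1%:M := CX.
pose M := Z *m X^T.
have maxM Q : Q^T *m Q = 1%:M -> mxdot Q M <= mxdot 1%:M M.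
  move=> Q1; rewrite -!mxdot_mulr mul1mx; apply: maxX.
  by rewrite /orthonormal_mx /= trmx_mul mulmxA -(mulmxA X^T) Q1 mulmx1.
have ZX : X *m Z^T = Z *m X^T.
  by have := maximal_trace_sym maxM; rewrite /M trmx_mul trmxK.
have S_sym : Z^T *m X = X^T *m Z.
  have := congr1 (fun A => X^T *m A *m X) ZX.
  by rewrite !mulmxA X1 mul1mx -(mulmxA _ X^T) X1 mulmx1.
exists (X^T *m Z); split; last 1 first.
(* As [Z *m v = M *m (X *m v)], the quadratic form of [S] at [v] is that of [M] at [X *m v]. *)
- move=> v; rewrite -mulmxA -mxdot_mull -[Z]mulmx1 -X1 mulmxA -(mulmxA _ X).
  exact: maximal_trace_psd.
- by rewrite -S_sym mulmxA ZX -mulmxA X1 mulmx1.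
- by rewrite trmx_mul trmxK.
Qed.

End Stiefel.

(** * Spectral theorem for real symmetric matrices *)

Section SpectralTheorem.
Context {R : realType}.

(** Over the complex numbers [A] is Hermitian, hence unitarily diagonalizable with real spectrum; a
    real eigenvalue of the complexification is already an eigenvalue over [R]. *)
Lemma symmetric_eigenvalue n (A : 'M[R]_n.+1) : A^T = A -> exists a, eigenvalue
  A a.
Proof.
move=> A_sym; pose AC := map_mx (real_complex R) A.
have AC_real : AC \is a mxOver Num.real.
  by apply/mxOverP => i j; rewrite mxE complex_real.
have AC_herm : AC \is hermsymmx.
  apply: realsym_hermsym => //; apply/is_hermitianmxP.
  by rewrite expr0 scale1r map_mx_id // map_trmx A_sym.
have /hermitian_normalmx /orthomx_spectralP := AC_herm.
have /mxOverP /(_ 0 0) := hermitian_spectral_diag_real AC_herm.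
have := spectral_unit AC.
move: (spectralmx AC) (spectral_diag AC) => U d U_unit /complex_realP[a da] ACE.
exists a; rewrite -(eigenvalue_map (real_complex R)) -/AC; apply/eigenvalueP.
exists (row 0 U).
  rewrite -row_mul ACE -mulmxA mulKVmx // row_mul row_diag_mx -scalemxAl da.
  by rewrite -rowE.
apply: contraTneq U_unit => U0; rewrite unitmxE (expand_det_row _ 0).
rewrite big1 ?unitr0 // => j _; have := congr1 (fun M : 'rV_n.+1 => M 0 j) U0.
by rewrite !mxE => ->; rewrite mul0r.
Qed.

(** Equal norms give [mxdot (u - w) w = - mxdot (u - w) (u - w) / 2], so reflecting [w] adds [u - w]
    to it. *)
Lemma reflection_swap n (u w : 'cV[R]_n) :
  mxdot u u = mxdot w w -> reflection (u - w) *m w = u.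
Proof.
move=> uw; have [->|d0] := eqVneq u w.
  by rewrite subrr /reflection mul0mx scaler0 subr0 mul1mx.
rewrite -subr_eq0 -mxdot_gt0 in d0.
have E : mxdot (u - w) w = - (mxdot (u - w) (u - w) / 2).
  by rewrite !mxdot_simp (mxdotC w u) uw; field.
rewrite /reflection mulmxBl mul1mx -scalemxAl -mulmxA mul_cV_dot mul_mx_scalar
  scalerA E.
move: d0; move: (mxdot _ _) => D d0; have -> : 2 / D * - (D / 2) = -1.
  by field; rewrite gt_eqF.
by rewrite scaleN1r opprK addrC subrK.
Qed.

(** Deflation: a reflection [Q] sends the first basis vector to a unit eigenvector, so [Q *m A *m Q]
    splits into the eigenvalue and a smaller symmetric block. *)
Theorem symmetric_spectral n (A : 'M[R]_n) : A^T = A ->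
  exists (V : 'M[R]_n) (d : 'rV[R]_n), V^T *m V = 1%:M /\ A *m V = V *m diag_mx
    d.
Proof.
elim: n A => [|n IHn] A A_sym.
  by exists 1%:M, 0; split; apply/matrixP => -[].
have [a /eigenvalueP[x xA x0]] := symmetric_eigenvalue A_sym.
pose v := (frob_norm x)^-1 *: x^T; pose o : 'I_(1 + n) := lshift n 0; pose e :
  'cV[R]_(1 + n) := delta_mx o 0.
have ee : mxdot e e = 1.
  rewrite mxdotE big_ord1 (bigD1 o) //= !mxE !eqxx mul1r big1 ?addr0 // => i
    /negPf i0.
  by rewrite !mxE i0 mul0r.
have vv : mxdot v v = mxdot e e.
  rewrite ee /v !mxdot_simp mxdot_tr -sqr_frob_norm.
  by field; rewrite frob_norm_eq0.
(* The vector [x] is a left eigenvector; its transpose is a right one by symmetry of [A]. *)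
have Av : A *m v = a *: v.
  by rewrite /v -scalemxAr -[A]trmxK A_sym -trmx_mul xA linearZ /= !scalerA
    mulrC.
pose Q := reflection (v - e); have Qe : Q *m e = v by exact: reflection_swap.
have Q_sym : Q^T = Q by exact: tr_reflection.
have QQ : Q *m Q = 1%:M by rewrite -{1}Q_sym reflection_orthogonal.
have [B BQ] : exists B : 'M[R]_(1 + n), B = Q *m A *m Q by exists (Q *m A *m Q).
have B_sym : B^T = B by rewrite BQ !trmx_mul Q_sym A_sym mulmxA.
have Be : B *m e = a *: e.
  by rewrite BQ -!mulmxA Qe Av -scalemxAr -Qe mulmxA QQ mul1mx.
have BE : B = block_mx a%:M 0 0 (drsubmx B).
  have Bi0 i : B i o = a * (i == o)%:R.
    by have := congr1 (fun M : 'cV_(1 + n) => M i 0) Be; rewrite -colE !mxE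
      andbT.
  rewrite -[LHS]submxK; congr block_mx.
  - by apply/matrixP => i j; rewrite !ord1 !mxE Bi0 eqxx mulr1 mulr1n.
  - apply/matrixP => i j; rewrite !ord1 -B_sym !mxE Bi0 (eq_sym _ o).
    by rewrite eq_lrshift mulr0.
  - apply/matrixP => i j; rewrite !ord1 !mxE Bi0 (eq_sym _ o).
    by rewrite eq_lrshift mulr0.
have [|V [d [V1 BV]]] := IHn (drsubmx B); first by rewrite trmx_drsub B_sym.
pose W : 'M[R]_(1 + n) := block_mx 1%:M 0 0 V.
have W1 : W^T *m W = 1%:M.
  rewrite /W tr_block_mx mulmx_block !trmx0 trmx1 !mulmx0 !mul0mx mul1mx addr0
    !add0r V1.
  by rewrite -scalar_mx_block.
have BW : B *m W = W *m diag_mx (row_mx a%:M d).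
  rewrite BE /W diag_mx_row !mulmx_block !mulmx0 !mul0mx !mulmx1 !mul1mx BV.
  rewrite !addr0 !add0r; congr (block_mx _ _ _ _).
  by apply/matrixP => i j; rewrite !ord1 !mxE.
exists (Q *m W), (row_mx a%:M d); split.
  by rewrite trmx_mul mulmxA -(mulmxA _ Q^T) Q_sym QQ mulmx1.
rewrite -mulmxA -BW BQ !mulmxA QQ mul1mx //.
Qed.

(** [V] intertwines the two characteristic matrices over the polynomials, and its determinant, a
    nonzero constant, cancels. *)
Lemma char_poly_diagonalizable n (A V : 'M[R]_n) d : V \in unitmx ->
  A *m V = V *m diag_mx d -> char_poly A = \prod_(i < n) ('X - (d 0 i)%:P).
Proof.
move=> V_unit AV.
have : char_poly_mx A *m map_mx polyC V = map_mx polyC V *m char_poly_mx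
  (diag_mx d).
  rewrite /char_poly_mx mulmxBl mulmxBr -!map_mxM AV; congr (_ - _).
  by rewrite scalar_mxC.
move=> /(congr1 determinant); rewrite !det_mulmx mulrC => /mulfI H.
rewrite /char_poly H; last by rewrite det_map_mx polyC_eq0 -unitfE -unitmxE.
rewrite -/(char_poly _) char_poly_trig; last exact: diag_mx_is_trig.
by apply: eq_bigr => i _; rewrite mxE eqxx.
Qed.

End SpectralTheorem.

(** * Roots of split polynomials, with multiplicity *)

Lemma perm_flatten_count (T : eqType) (s t : seq T) :
  uniq s -> {subset t <= s} ->
  perm_eq (flatten [seq nseq (count_mem x t) x | x <- s]) t.
Proof.
move=> s_uniq ts; apply/allP => y _ /=; rewrite count_flatten -map_comp sumnE
  big_map.
rewrite (eq_bigr (fun x => (x == y) * count_mem x t)%N); last first.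
  by move=> x _ /=; rewrite count_nseq.
have [ys|ys] := boolP (y \in s).
  rewrite (bigD1_seq y) //= eqxx mul1n big1 ?addn0 // => x /negPf xy.
  by rewrite xy mul0n.
rewrite big1_seq ?(count_memPn _) ?(contra (ts y)) //.
by move=> x /andP[_ xs]; case: eqP xs ys => // -> ->.
Qed.

(** Taking [f] to be the square root gives the sequence in [singular_values], which can thus be read
    off any factorization into linear factors. *)
Lemma rootsR_prod_XsubC (R : rcfType) (T : eqType) (f : R -> T) (s : seq R) p :
  p = \prod_(y <- s) ('X - y%:P) ->
  perm_eq (flatten [seq nseq (mup x p) (f x) | x <- rootsR p]) (map f s).
Proof.
move=> pE; have p0 : p != 0.
  by rewrite pE monic_neq0 // monic_prod_XsubC.
have -> : flatten [seq nseq (mup x p) (f x) | x <- rootsR p] =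
  map f (flatten [seq nseq (count_mem x s) x | x <- rootsR p]).
  rewrite map_flatten -map_comp; congr flatten; apply: eq_map => x /=.
  by rewrite map_nseq pE mu_prod_XsubC.
apply/perm_map/perm_flatten_count; first apply: (sorted_uniq lt_trans
  lt_irreflexive (sorted_roots _ _ _)).
move=> x xs; have := roots_on_rootsR p0 x; rewrite in_itv /= => <-.
by rewrite pE root_prod_XsubC.
Qed.

(** * Singular values and the spectral norm *)

Section SingularValues.
Context {R : realType} {n r : nat}.
Implicit Types X Y Z W : 'M[R]_(n, r).

Lemma col_orthogonal m (V : 'M[R]_m) i j : V^T *m V = 1%:M ->
  mxdot (col i V) (col j V) = (i == j)%:R.
Proof.
move/(congr1 (fun M : 'M[R]_m => M i j)); rewrite mxE [RHS]mxE => <-.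
by rewrite mxdotE big_ord1; apply: eq_bigr => k _; rewrite !mxE.
Qed.

Lemma mul_diag_col m (A V : 'M[R]_m) d i :
  A *m V = V *m diag_mx d -> A *m col i V = d 0 i *: col i V.
Proof.
move=> AV; rewrite [in LHS]colE mulmxA AV -colE mul_mx_diag.
by apply/matrixP => k l; rewrite !mxE mulrC.
Qed.

(** The columns of [V] are right singular vectors: the eigenvalue of [X^T *m X] at a unit column [v]
    is the squared norm of [X *m v], hence nonnegative. *)
Lemma singular_valuesP X : exists (V : 'M[R]_r) (s : 'I_r -> R),
  [/\ V^T *m V = 1%:M, forall i, 0 <= s i,
      X^T *m X *m V = V *m diag_mx (\row_i s i ^+ 2)
    & perm_eq (singular_values X) [seq s i | i <- enum 'I_r]].
Proof.
have [|V [d [V1 XV]]] := @symmetric_spectral R r (X^T *m X).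
  by rewrite trmx_mul trmxK.
have Xv i := mul_diag_col i XV.
have v1 i : mxdot (col i V) (col i V) = 1 by rewrite col_orthogonal ?eqxx.
have d0 i : 0 <= d 0 i.
  have -> : d 0 i = mxdot (X *m col i V) (X *m col i V).
    by rewrite mxdot_mull mulmxA Xv mxdotZr v1 mulr1.
  exact: mxdot_ge0.
exists V, (fun i => Num.sqrt (d 0 i)); split => //.
  by rewrite XV; congr (V *m diag_mx _); apply/rowP => i; rewrite mxE sqr_sqrtr.
rewrite /singular_values; have V_unit : V \in unitmx by case: (mulmx1_unit V1).
have pE : char_poly (X^T *m X) = \prod_(y <- [seq d 0 i | i <- enum 'I_r]) ('X -
  y%:P).
  by rewrite (char_poly_diagonalizable V_unit XV) big_map big_enum.
by rewrite (perm_trans (rootsR_prod_XsubC _ pE)) // -map_comp.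
Qed.

Lemma nuc_norm_perm X (s : 'I_r -> R) :
  perm_eq (singular_values X) [seq s i | i <- enum 'I_r] -> nuc_norm X = \sum_i
    s i.
Proof. by move=> Xs; rewrite /nuc_norm (perm_big _ Xs) big_map big_enum. Qed.

Lemma sp_norm_perm X (s : 'I_r -> R) :
  perm_eq (singular_values X) [seq s i | i <- enum 'I_r] ->
  sp_norm X = \big[Num.max/0]_i s i.
Proof. by move=> Xs; rewrite /sp_norm (perm_big _ Xs) big_map big_enum. Qed.

Lemma sp_norm_ge0 X : 0 <= sp_norm X.
Proof.
by have [V [s [_ _ _ /sp_norm_perm ->]]] := singular_valuesP X; exact:
  bigmax_ge_id.
Qed.

(** With [W = V *m Y] in the eigenbasis of [X^T *m X], the squared norm of [X *m W] is the sum of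
    the [s i ^+ 2 * Y i j ^+ 2]. *)
Lemma frob_norm_mul_sp k X (W : 'M[R]_(r, k)) :
  frob_norm (X *m W) <= sp_norm X * frob_norm W.
Proof.
have [V [s [V1 s0 XV /sp_norm_perm spE]]] := singular_valuesP X.
rewrite -ler_sqr ?nnegrE ?mulr_ge0 ?frob_norm_ge0 ?sp_norm_ge0 // exprMn
  !sqr_frob_norm.
have [Y WY] : exists Y : 'M[R]_(r, k), W = V *m Y.
  by exists (V^T *m W); rewrite mulmxA (mulmx1C V1) mul1mx.
rewrite WY (mxdot_isometry _ _ V1) mxdot_mull !mulmxA XV -(mulmxA V)
  (mxdot_isometry _ _ V1).
rewrite !mxdotE mulr_sumr; apply: ler_sum => j _; rewrite mulr_sumr; apply:
  ler_sum => i _.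
rewrite mul_diag_mx !mxE mulrCA -expr2 ler_wpM2r ?sqr_ge0 // ler_sqr ?nnegrE
  ?sp_norm_ge0 //.
by rewrite spE; exact: le_bigmax.
Qed.

Lemma sp_norm_eigenvector X : (0 < r)%N -> exists v : 'cV[R]_r,
  mxdot v v = 1 /\ X^T *m X *m v = sp_norm X ^+ 2 *: v.
Proof.
move=> r0; have [V [s [V1 s0 XV /sp_norm_perm spE]]] := singular_valuesP X.
(* As ['I_r] is inhabited and every [s i] is nonnegative, the maximum is attained at an index
   despite its default value 0. *)
have [|i _ spi] := @eq_bigmax _ _ _ 0 (Ordinal r0) xpredT s isT; first by [].
by exists (col i V); rewrite (col_orthogonal _ _ V1) eqxx (mul_diag_col i XV)
  mxE spE spi.
Qed.

End SingularValues.

(** * Duality of the nuclear and spectral norms *)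

Section DualNorm.
Context {R : realType} {n r : nat}.
Implicit Types X Y Z W : 'M[R]_(n, r).

(** In the right singular basis of [X], the term at the column [v] is at most the norm of [X *m v],
    a singular value, times that of [Z *m v]. *)
Lemma mxdot_le_nuc_sp X Z : mxdot X Z <= nuc_norm X * sp_norm Z.
Proof.
have [V [s [V1 s0 XV /nuc_norm_perm ->]]] := singular_valuesP X.
rewrite (mxdot_parseval _ _ V1) mulr_suml; apply: ler_sum => i _.
have v1 : mxdot (col i V) (col i V) = 1 by rewrite col_orthogonal ?eqxx.
have -> : s i = frob_norm (X *m col i V).
  rewrite /frob_norm mxdot_mull mulmxA (mul_diag_col i XV) mxE mxdotZr v1 mulr1.
  by rewrite sqrtr_sqr ger0_norm.
rewrite (le_trans (mxdot_le _ _)) // ler_wpM2l ?frob_norm_ge0 //.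
by rewrite (le_trans (frob_norm_mul_sp _ _)) // /frob_norm v1 sqrtr1 mulr1.
Qed.

(** When [X^T *m X] is idempotent, each singular value is 0 or 1 and so equals its square. *)
Lemma nuc_norm_partial_isometry X :
  X^T *m X *m (X^T *m X) = X^T *m X -> nuc_norm X = mxdot X X.
Proof.
move=> XX; have [V [s [V1 s0 XV /nuc_norm_perm ->]]] := singular_valuesP X.
rewrite (mxdot_parseval _ _ V1); apply: eq_bigr => i _.
have v1 : mxdot (col i V) (col i V) = 1 by rewrite col_orthogonal ?eqxx.
have Xv := mul_diag_col i XV; rewrite mxE in Xv.
rewrite mxdot_mull mulmxA Xv mxdotZr v1 mulr1.
have : s i ^+ 2 * s i ^+ 2 = s i ^+ 2.
  rewrite -[RHS]mulr1 -v1 -[RHS]mxdotZr -Xv -XX -mulmxA Xv -scalemxAr Xv.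
  by rewrite !mxdotZr v1 mulr1.
have := s0 i; rewrite le_eqVlt => /predU1P[<-|si]; first by rewrite expr0n.
move=> /eqP; rewrite -subr_eq0 -{3}[s i ^+ 2]mulr1 -mulrBr mulf_eq0 sqrf_eq0
  gt_eqF //=.
by rewrite subr_eq0 sqrp_eq1 ?(ltW si) // => /eqP ->; rewrite expr1n.
Qed.

(** The bound of [mxdot_le_nuc_sp] is attained at the rank-one partial isometry [u *m v^T], with [v]
    a top right singular vector of [Z] and [u] the normalized image [Z *m v]. *)
Lemma dual_nuc_norm Z : (0 < r)%N -> dual_norm (@nuc_norm R n r) Z = sp_norm Z.
Proof.
move=> r0; pose A := [set mxdot X Z | X in [set X | nuc_norm X <= 1]].
have A_ub : ubound A (sp_norm Z).
  move=> _ [X /= X1 <-]; rewrite (le_trans (mxdot_le_nuc_sp _ _)) //.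
  by rewrite ler_piMl ?sp_norm_ge0.
suff A_sp : A (sp_norm Z).
  apply/eqP; rewrite eq_le; apply/andP; split; first by apply: ge_sup => //;
    exists (sp_norm Z).
  by apply: ub_le_sup => //; exists (sp_norm Z).
have [v [v1 Zv]] := sp_norm_eigenvector Z r0; set t := sp_norm Z in Zv *.
have ZZv : mxdot (Z *m v) (Z *m v) = t ^+ 2.
  by rewrite mxdot_mull mulmxA Zv mxdotZr v1 mulr1.
(* [t^-1 = 0] when [t = 0], so that [u] is then the zero vector. *)
have [u uE] : exists u, u = t^-1 *: (Z *m v) by exists (t^-1 *: (Z *m v)).
have uu : mxdot u u = t^-1 * t.
  rewrite uE mxdotZl mxdotZr ZZv; have [->|t0] := eqVneq t 0; first by rewrite
    expr0n !mulr0.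
  by field.
have c1 : t^-1 * t * (t^-1 * t) = t^-1 * t.
  by have [->|t0] := eqVneq t 0; rewrite ?mulr0 // mulVf // mulr1.
have XX : (u *m v^T)^T *m (u *m v^T) = (t^-1 * t) *: (v *m v^T).
  rewrite trmx_mul trmxK mulmxA -(mulmxA v) mul_cV_dot uu mul_mx_scalar.
  by rewrite -scalemxAl.
exists (u *m v^T) => /=; last first.
  rewrite mxdot_mulr_tr uE mxdotZl ZZv; have [->|t0] := eqVneq t 0; first by
    rewrite expr0n mulr0.
  by rewrite expr2 mulKf.
rewrite nuc_norm_partial_isometry; last first.
  rewrite XX -scalemxAl -scalemxAr scalerA c1; congr (_ *: _).
  by rewrite mulmxA -(mulmxA v) mul_cV_dot v1 mulmx1.
rewrite mxdot_mulr_tr -mulmxA mul_cV_dot v1 mulmx1 uu.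
by have [->|t0] := eqVneq t 0; rewrite ?mulr0 // mulVf.
Qed.

End DualNorm.

(** * Chords of the Stiefel manifold: concavity, compatibility, continuity *)

Section StiefelGeometry.
Context {R : realType} {n r : nat}.
Implicit Types X Y Z W : 'M[R]_(n, r).
Local Notation C := (@orthonormal_mx R n r).

(* [X *m H] is normal to the Stiefel manifold at [X]; the identity is exact and
   quadratic in the chord [X - Y], which is what yields the constant 1/2. *)
Lemma mxdot_normal_chord X Y (H : 'M[R]_r) : C X -> C Y -> H^T = H ->
  mxdot (X *m H) (X - Y) = 2^-1 * mxdot (X - Y)^T (H *m (X - Y)^T).
Proof.
move=> CX CY H_sym.
have -> : H *m (X - Y)^T = ((X - Y) *m H)^T by rewrite trmx_mul H_sym.
rewrite mxdot_tr mulmxBl !mxdot_simp (mxdotC (X *m H) Y).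
(* The diagonal terms both equal [\tr H] and the cross terms agree, so the quadratic side is twice
   the linear one. *)
have normal W : C W -> mxdot W (W *m H) = \tr H by move=> CW; rewrite /mxdot
  mulmxA CW mul1mx.
have -> : mxdot X (Y *m H) = mxdot Y (X *m H) by rewrite mxdotC mxdot_mulr
  H_sym.
by rewrite (mxdotC (X *m H)) !normal //; field.
Qed.

Lemma concavity_le Z X Y : C Y -> is_proj C Z X ->
  mxdot (Y - X) (Z - X) <= 2^-1 * (sp_norm (Z - X) * frob_norm (Y - X) ^+ 2).
Proof.
move=> CY projZ; have [CX _] := projZ; have [S [ZE S_sym _]] := is_proj_polar
  projZ.
have ZXE : Z - X = X *m (S - 1%:M) by rewrite mulmxBr mulmx1 -ZE.
have H_sym : (S - 1%:M)^T = S - 1%:M by rewrite linearB /= S_sym trmx1.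
rewrite -(opprB X Y) mxdotNl frob_normN (mxdotC _ (Z - X)) {1}ZXE
  mxdot_normal_chord //.
(* Applying the isometry [X] to both arguments turns [S - 1%:M] into [Z - X], whose spectral norm
   then appears after Cauchy-Schwarz. *)
rewrite -mulrN ler_pM2l ?invr_gt0 // -mxdotNl -(mxdot_isometry _ _ CX) mulmxA
  -ZXE.
rewrite (le_trans (mxdot_le _ _)) // mulmxN frob_normN (frob_norm_isometry _
  CX).
have := frob_norm_mul_sp (Z - X) (X - Y)^T; rewrite frob_norm_tr expr2 => H.
by rewrite mulrCA ler_wpM2l ?frob_norm_ge0.
Qed.

Lemma sp_norm_orthonormal X : (0 < r)%N -> C X -> sp_norm X = 1.
Proof.
move=> r0 CX; have [v [v1]] := sp_norm_eigenvector X r0.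
move=> /(congr1 (mxdot v)); rewrite CX mul1mx mxdotZr v1 mulr1 => /esym/eqP.
by rewrite sqrp_eq1 ?sp_norm_ge0 // => /eqP.
Qed.

Lemma sp_norm_proj_le Z X Y : (0 < r)%N -> is_proj C Z X -> C Y ->
  sp_norm (Z - X) <= sp_norm (Z - Y).
Proof.
move=> r0 projZ CY; have [CX _] := projZ; have [S [ZE S_sym S_psd]] :=
  is_proj_polar projZ.
have [v [v1 Hv]] := sp_norm_eigenvector (Z - X) r0.
set t := sp_norm (Z - X) in Hv *; have t0 : 0 <= t := sp_norm_ge0 _.
have ZXE : Z - X = X *m (S - 1%:M) by rewrite mulmxBr mulmx1 -ZE.
have H_sym : (S - 1%:M)^T = S - 1%:M by rewrite linearB /= S_sym trmx1.
rewrite ZXE trmx_mul H_sym mulmxA -(mulmxA _ X^T) CX mulmx1 in Hv.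
have v0 : v != 0 by rewrite -mxdot_gt0 v1.
(* With [H = S - 1%:M], the vector [v] satisfies [H *m H *m v = t ^+ 2 *: v]. Either
   [H *m v + t *: v] vanishes and [v] has eigenvalue [- t], or that vector has eigenvalue [t]. *)
have [u [a [u0 at_ Hu]]] : exists (u : 'cV[R]_r) (a : R),
    [/\ u != 0, `|a| = t & (S - 1%:M) *m u = a *: u].
  have [u0|u0] := eqVneq ((S - 1%:M) *m v + t *: v) 0.
    exists v, (- t); split=> //; first by rewrite normrN ger0_norm.
    by apply/eqP; rewrite scaleNr -subr_eq0 opprK u0.
  exists ((S - 1%:M) *m v + t *: v), t; split=> //; first by rewrite ger0_norm.
  by rewrite mulmxDr mulmxA Hv -scalemxAr scalerDr scalerA -expr2 addrC.
have Su : S *m u = (1 + a) *: u.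
  by rewrite scalerDl scale1r -Hu mulmxBl mul1mx addrC subrK.
have u_gt0 : 0 < frob_norm u by rewrite lt_def frob_norm_eq0 u0 frob_norm_ge0.
have a1 : 0 <= 1 + a.
  by have := S_psd u; rewrite Su mxdotZr pmulr_lge0 // mxdot_gt0.
(* Since [1 + a >= 0], the norms of [Z *m u] and [Y *m u] are [1 + a] and 1 times that of [u]; they
   differ by [t] times it. *)
rewrite -(ler_pM2r u_gt0) (le_trans _ (frob_norm_mul_sp _ _)) //.
rewrite mulmxBl (le_trans _ (frob_normB_ge _ _)) //.
rewrite ZE -mulmxA (frob_norm_isometry _ CX) (frob_norm_isometry _ CY) Su
  frob_normZ (ger0_norm a1).
by rewrite mulrDl mul1r addrAC subrr add0r normrM at_ (gtr0_norm u_gt0).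
Qed.

(** The chord identity with [H = S], after splitting [Z] as [X + (Z - X)]: the first summand gives
    the full square, the second is a perturbation bounded by Cauchy-Schwarz. *)
Lemma mxdot_proj_chord_ge Z X Y : is_proj C Z X -> C Y ->
  (1 - frob_norm (Z - X)) / 2 * mxdot (X - Y) (X - Y) <= mxdot Z (X - Y).
Proof.
move=> projZ CY; have [CX _] := projZ; have [S [ZE S_sym _]] := is_proj_polar
  projZ.
rewrite {2}ZE mxdot_normal_chord // mulrAC mulrC ler_pM2l ?invr_gt0 //.
have [D DE] : exists D, D = (X - Y)^T by exists (X - Y)^T.
rewrite -(mxdot_tr (X - Y)) -DE -(mxdot_isometry D (S *m D) CX) mulmxA -ZE.
have -> : Z *m D = X *m D - (- ((Z - X) *m D)) by rewrite opprK mulmxBl addrC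
  subrK.
rewrite mxdotDr mxdotNr (mxdot_isometry _ _ CX) mulrBl mul1r lerD2l lerN2.
rewrite (le_trans (mxdot_le _ _)) // frob_normN (frob_norm_isometry _ CX).
rewrite -sqr_frob_norm expr2 mulrCA ler_wpM2l ?frob_norm_ge0 //.
exact: frob_norm_mul.
Qed.

(** Both projections lie within 1/2 of their points, so each chord bound has coefficient at least
    1/4. Their sum bounds half the square of [X - X'] by [mxdot (Z - Z') (X - X')]. *)
Lemma proj_lipschitz X0 Z Z' X X' : C X0 ->
  frob_norm (X0 - Z) <= 2^-1 -> frob_norm (X0 - Z') <= 2^-1 ->
  is_proj C Z X -> is_proj C Z' X' ->
  frob_norm (X - X') <= 2 * frob_norm (Z - Z').
Proof.
move=> CX0 Z0 Z0' projZ projZ'; have [CX minX] := projZ; have [CX' minX'] :=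
  projZ'.
have H := mxdot_proj_chord_ge projZ CX'; have H' := mxdot_proj_chord_ge projZ'
  CX.
have := minX _ CX0; have := minX' _ CX0.
rewrite -(opprB Z X) -(opprB Z' X') !frob_normN => ZX' ZX.
have [D DE] : exists D, D = X - X' by exists (X - X').
rewrite -[X' - X]opprB -DE !(mxdotNl, mxdotNr) opprK in H'; rewrite -DE in H *.
have [->|D0] := eqVneq (frob_norm D) 0; first by rewrite mulr_ge0
  ?frob_norm_ge0.
have D_gt0 : 0 < frob_norm D by rewrite lt_def D0 frob_norm_ge0.
have := mxdot_le (Z - Z') D; rewrite mxdotDl mxdotNl => HD.
rewrite -(ler_pM2r D_gt0) -mulrA; rewrite -!sqr_frob_norm in H H'.
have D2 := sqr_ge0 (frob_norm D); rewrite -expr2.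
have : (1 - frob_norm (Z - X)) / 2 >= 4^-1 by lra.
have : (1 - frob_norm (Z' - X')) / 2 >= 4^-1 by lra.
move=> /(ler_wpM2r D2) h' /(ler_wpM2r D2) h; lra.
Qed.

(** The matrix topology comes from the largest absolute value of an entry, hence this comparison and
    its converse. *)
Lemma norm_le_frob_norm X : `|X| <= frob_norm X.
Proof.
rewrite [leLHS]mx_normrE; apply: bigmax_le; first exact: frob_norm_ge0.
move=> [i j] _ /=; rewrite -ler_sqr ?nnegrE ?frob_norm_ge0 // sqr_frob_norm
  mxdotE.
rewrite (bigD1 j) //= (bigD1 i) //= real_normK ?num_real // expr2 -addrA lerDl.
by rewrite addr_ge0 ?sumr_ge0 // => *; rewrite ?sumr_ge0 // => *; rewrite -expr2
  sqr_ge0.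
Qed.

(** The factor is cruder than the square root of [n * r]; the successor keeps it positive, so radii
    can be divided by it. *)
Lemma frob_norm_le_norm X : frob_norm X <= (n * r).+1%:R * `|X|.
Proof.
rewrite -ler_sqr ?nnegrE ?mulr_ge0 ?frob_norm_ge0 // sqr_frob_norm mxdotE.
have le1 i j : X i j * X i j <= `|X| ^+ 2.
  rewrite -expr2 -[leLHS]real_normK ?num_real // ler_sqr ?nnegrE //.
  rewrite [leRHS]mx_normrE; exact: (le_bigmax _ (fun ij => `|X ij.1 ij.2|) (i,
    j)).
apply: (@le_trans _ _ (\sum_(j < r) \sum_(i < n) `|X| ^+ 2)).
  by apply: ler_sum => j _; apply: ler_sum => i _.
rewrite !sumr_const !card_ord -mulrnA -[leLHS]mulr_natl exprMn ler_wpM2r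
  ?sqr_ge0 //.
by rewrite -natrX ler_nat (leq_trans (leqnSn _)) // expnS leq_pmulr.
Qed.

(** Any selection [P] is Lipschitz on the ball of radius [2^-1 / K], whose points are within
    Frobenius distance 1/2 of [X]. *)
Lemma projection_nondegenerate P X : projection C P -> C X -> ~ degenerate C P
  X.
Proof.
move=> projP CX [_]; apply; pose K : R := (n * r).+1%:R.
have K_gt0 : 0 < K by rewrite ltr0n.
have e0 : 0 < 2^-1 / K by rewrite divr_gt0.
have U_frob Z : ball X (2^-1 / K) Z -> frob_norm (X - Z) <= 2^-1.
  rewrite -ball_normE /= => /ltW XZ; rewrite (le_trans (frob_norm_le_norm _))
    //.
  by rewrite mulrC -ler_pdivlMr.
exists (ball X (2^-1 / K)); first exact: nbhsx_ballx.
apply: continuous_in_subspaceT => Z /set_mem UZ.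
apply: (iffRL (@cvgrPdist_le _ _ _ _ (nbhs_filter Z) _ _)) => e e_gt0.
(* The 2 is the Lipschitz constant, and [K] converts the entrywise norm to the Frobenius norm. *)
have d_gt0 : 0 < e / 2 / K by rewrite !divr_gt0.
have UZ_nbhs : nbhs Z (ball X (2^-1 / K)).
  by apply: open_nbhs_nbhs; split=> //; exact: ball_open.
apply: (@filterS2 _ _ (nbhs_filter Z) _ _ _ _ UZ_nbhs (nbhsx_ballx Z _ d_gt0))
  => Z' UZ' ZZ'.
rewrite (le_trans (norm_le_frob_norm _)) //.
rewrite (le_trans (proj_lipschitz CX (U_frob _ UZ) (U_frob _ UZ') (projP _)
  (projP _))) //.
rewrite mulrC -ler_pdivlMr // (le_trans (frob_norm_le_norm _)) // mulrC
  -ler_pdivlMr //.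
by rewrite -ball_normE /= in ZZ'; exact: ltW.
Qed.

End StiefelGeometry.

Theorem lemma11 (R : realType) (n r : nat) (r_gt0 : (1 <= r)%N) (le_rn : (r <= n)%N)
    (P : 'M[R]_(n, r) -> 'M[R]_(n, r))
    (projP : projection (@orthonormal_mx R n r) P) :
  [/\ forall Z : 'M[R]_(n, r), dual_norm (@nuc_norm R n r) Z = sp_norm Z,
      forall X : 'M[R]_(n, r), orthonormal_mx X ->
        local_concavity_coeff (@orthonormal_mx R n r) (@nuc_norm R n r) P X
          (2^-1)%:E
    & norm_compatible (@orthonormal_mx R n r) (@sp_norm R n r) P 1].
Proof.
split=> [Z|X CX|Z]; first exact: dual_nuc_norm.
- have nondeg := projection_nondegenerate projP CX.
  split=> [//|_]; split.
    split=> [|Y Z CY projZ]; first by rewrite lee_fin invr_ge0.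
    by rewrite -EFinM lee_fin dual_nuc_norm //; exact: concavity_le.
  (* At [Z = 0], [Y = - X] the bound reads [2 * mxdot X X <= h * (4 * mxdot X X)], and
     [mxdot X X = r] is positive. *)
  move=> h [h0 h_bound]; have CNX : orthonormal_mx (- X).
    have XN : (- X)^T = - X^T by apply/matrixP => i j; rewrite !mxE.
    by rewrite /orthonormal_mx /= XN mulNmx mulmxN opprK.
  have := h_bound _ _ CNX (is_proj0 CX).
  rewrite dual_nuc_norm // sub0r sp_norm_orthonormal // mul1r sqr_frob_norm.
  rewrite -opprD !(mxdotNl, mxdotNr, mxdotDl, mxdotDr) !opprK.
  have XX : 0 < mxdot X X.
    by rewrite (mxdot_orthonormal CX) mxtrace1 ltr0n.
  case: h h0 {h_bound} => [h| |] // h0; last by rewrite leey.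
  by rewrite -EFinM !lee_fin; nra.
(* The minimum is attained at [P Z] itself, so equality holds with [phi = 1]. *)
- have [CPZ _] := projP Z; exists (sp_norm (Z - P Z)); last by rewrite mul1r.
  split; first by exists (P Z).
  by move=> _ [Y CY <-]; exact: sp_norm_proj_le.
Qed.
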